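(* Let $G$ be an Abelian group equipped with a symmetric generating family $S=\{e_1^+,\dots,e_N^+,e_1^-,\dots,e_N^-\}$, where $e_i^-=(e_i^+)^{-1}$ for all $i$, and $S$ does not contain the identity element. Then the Cayley graph of $G$ related to $S$ satisfies $CD(0,2N)$.
   Context: $S$ generating means every element of $G$ is a finite product of elements of $S$. The Cayley graph of $G$ related to the finite symmetric generating set $S$ has vertex set $G$, with $x\sim y$ if and only if $y=xs$ for some $s\in S$. In this setting the Laplacian is $\Delta f(x)=\sum_{y\sim x}(f(y)-f(x))$ for $f:G\to\mathbb{R}$ (no normalizing constant). Set $\Gamma(f,g)=\frac12(\Delta(fg)-f\Delta g-g\Delta f)$, $\Gamma f=\Gamma(f,f)$, $\Gamma_2 f=\frac12\Delta(\Gamma f)-\Gamma(f,\Delta f)$. The graph satisfies $CD(0,m)$ if $\Gamma_2 f\ge\frac1m(\Delta f)^2$ pointwise for all functions $f:G\to\mathbb{R}$. *)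

(* Defs.v *)
From HB Require Import structures.
From mathcomp Require Import all_boot all_order all_algebra.
From mathcomp Require Import all_classical all_reals.

Set Implicit Arguments.
Unset Strict Implicit.
Unset Printing Implicit Defensive.

Import Order.TTheory GRing.Theory Num.Theory.

Local Open Scope classical_set_scope.
Local Open Scope ring_scope.

Section Curvature.
Context {R : realType} {V : choiceType}.
Variable adj : V -> V -> Prop.
Implicit Types f g : V -> R.

(* The sum over a set is [0] by convention when infinitely many terms are
   nonzero; this cannot occur on a locally finite graph. Each neighbour is
   counted once. *)
Definition laplacian f : V -> R :=
  fun x => \sum_(y \in [set y | adj x y]) (f y - f x).

Definition Gamma f g : V -> R := fun x =>
  2^-1 * (laplacian (fun y => f y * g y) x
          - f x * laplacian g x - g x * laplacian f x).

Definition Gamma2 f : V -> R := fun x =>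
  2^-1 * laplacian (Gamma f f) x - Gamma f (laplacian f) x.

Definition CD0 (m : R) : Prop :=
  forall f x, m^-1 * laplacian f x ^+ 2 <= Gamma2 f x.

End Curvature.

Arguments CD0 R {V} adj m.

Section Cayley.
Variable G : groupType.
Implicit Types S : set G.

Definition generates S : Prop :=
  forall x : G, exists2 w : seq G,
    (forall s, s \in w -> S s) & x = (\prod_(s <- w) s)%g.

Definition cayley_adj S (x y : G) : Prop := exists2 s, S s & y = (x * s)%g.

End Cayley.

(* Main.v *)
Require Import Defs.
From HB Require Import structures.
From mathcomp Require Import all_boot all_order all_algebra.
From mathcomp Require Import all_classical all_reals.
From mathcomp Require Import ring lra.

(** Write [D_a f x = f (x a) - f x].  The Cayley Laplacian is the sum of [D_a]
over the elements [a] of [S], and [Gamma f] is half the sum of the squares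
[(D_a f)^2].  In an Abelian group the operators [D_a] commute with one another,
hence with the Laplacian, so the discrete Bochner formula has no curvature term:
[Gamma2 f] is a quarter of the sum over all pairs [(a, b)] in [S x S] of the
squared second differences [(D_b D_a f)^2] ([Gamma2_cayley]).

Among these pairs keep only those with [b = a^-1].  There
[D_b D_a f = - (D_a f + D_b f)], and as [S] is symmetric the sum of
[D_a f + D_(a^-1) f] over [a] in [S] is twice the Laplacian.  The Cauchy-Schwarz
inequality over the at most [2N] elements of [S] ([sqr_sum_le]) then bounds
[Gamma2 f] from below by [(1/4) (1/(2N)) (2 Laplacian f)^2], which is the claim.
The family [e_i^+, e_i^-] may list an element several times, for instance when
[e_i] is an involution, while the graph counts each neighbour once; this is why
the argument runs over a duplicate-free enumeration of [S] of size at most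
[2N]. *)

Set Implicit Arguments.
Unset Strict Implicit.
Unset Printing Implicit Defensive.

Import Order.TTheory GRing.Theory Num.Theory.

Local Open Scope classical_set_scope.
Local Open Scope ring_scope.

(** Cauchy-Schwarz against the constant function [1], with any upper bound [n]
for the number of terms.  The proof expands the nonnegative sum of
[(u a - c)^2], where [c] is the sum divided by [n] rather than by the number of
terms; the case [n = 0] is covered by the convention [0^-1 = 0]. *)
Lemma sqr_sum_le (R : realFieldType) (T : Type) (r : seq T) (u : T -> R)
    (n : nat) :
  (size r <= n)%N ->
  n%:R^-1 * (\sum_(a <- r) u a) ^+ 2 <= \sum_(a <- r) u a ^+ 2.
Proof.
move=> le_rn; set U := \sum_(a <- r) u a; set c := U / n%:R.
have : 0 <= \sum_(a <- r) (u a - c) ^+ 2 by apply: sumr_ge0 => a _; exact: sqr_ge0.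
have -> : \sum_(a <- r) (u a - c) ^+ 2
    = \sum_(a <- r) u a ^+ 2 - 2 * c * U + (size r)%:R * c ^+ 2.
  rewrite mulr_sumr -sumrB -sum1_size natr_sum mulr_suml -big_split /=.
  by apply: eq_bigr => a _; ring.
have : (size r)%:R * c ^+ 2 <= n%:R * c ^+ 2.
  by rewrite ler_wpM2r ?sqr_ge0 // ler_nat.
have -> : n%:R * c ^+ 2 = c * U.
  rewrite /c; have [->|n0] := eqVneq (n%:R : R) 0; first by rewrite invr0; ring.
  by field.
have -> : n%:R^-1 * U ^+ 2 = c * U by rewrite /c; ring.
lra.
Qed.

Definition diffg (R : zmodType) (G : groupType) (a : G) (f : G -> R) : G -> R :=
  fun x => f (x * a)%g - f x.

Section FiniteCayley.
Variables (R : realType) (G : groupType) (s : seq G).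
Hypothesis s_uniq : uniq s.
Implicit Types f g : G -> R.

Let adj := cayley_adj [set` s].

Lemma laplacian_cayley f x : laplacian adj f x = \sum_(a <- s) diffg a f x.
Proof.
have nbrE : [set y | adj x y] = [set` [seq (x * a)%g | a <- s]].
  by apply/seteqP; split=> y /= => [[a sa ->]|/mapP[a sa ->]];
    [apply: map_f | exists a].
rewrite /laplacian nbrE -fsbig_seq ?big_map //.
by rewrite map_inj_uniq //; exact: mulgI.
Qed.

Lemma Gamma_cayley f g x :
  Gamma adj f g x = 2^-1 * \sum_(a <- s) diffg a f x * diffg a g x.
Proof.
rewrite /Gamma !laplacian_cayley !mulr_sumr -!sumrB mulr_sumr.
by apply: eq_bigr => a _; rewrite /diffg; ring.
Qed.

Hypothesis mulgC : forall x y : G, (x * y)%g = (y * x)%g.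

Lemma diffgC a b f x : diffg a (diffg b f) x = diffg b (diffg a f) x.
Proof. by rewrite /diffg -!mulgA (mulgC a b); ring. Qed.

Lemma diffg_laplacian a f x :
  diffg a (laplacian adj f) x = \sum_(b <- s) diffg b (diffg a f) x.
Proof.
rewrite {1}/diffg !laplacian_cayley -sumrB.
by apply: eq_bigr => b _; rewrite diffgC.
Qed.

(** The discrete Bochner formula.  Since differences commute with the Laplacian,
the contribution of a pair [(a, b)] to twice [Gamma2 f], with [p = D_a f x] and
[q = D_a f (x b)], is [(q^2 - p^2) / 2 - p (q - p) = (q - p)^2 / 2]. *)
Lemma Gamma2_cayley f x :
  Gamma2 adj f x =
  4^-1 * \sum_(a <- s) \sum_(b <- s) diffg b (diffg a f) x ^+ 2.
Proof.
rewrite /Gamma2 laplacian_cayley Gamma_cayley.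
have -> : \sum_(b <- s) diffg b (Gamma adj f f) x =
    2^-1 * \sum_(a <- s) \sum_(b <- s)
      (diffg a f (x * b)%g ^+ 2 - diffg a f x ^+ 2).
  rewrite exchange_big mulr_sumr; apply: eq_bigr => b _.
  by rewrite {1}/diffg !Gamma_cayley -mulrBr -sumrB.
rewrite !mulr_sumr -sumrB; apply: eq_bigr => a _.
rewrite diffg_laplacian !mulr_sumr -sumrB; apply: eq_bigr => b _.
have -> : diffg b (diffg a f) x = diffg a f (x * b)%g - diffg a f x by [].
by field.
Qed.

Hypothesis s_sym : forall a, a \in s -> (a^-1)%g \in s.

Lemma sum_diffgV f x :
  \sum_(a <- s) diffg a^-1%g f x = \sum_(a <- s) diffg a f x.
Proof.
rewrite -(big_map (fun a : G => a^-1%g) xpredT (fun a => diffg a f x)).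
apply: perm_big; apply: uniq_perm => //.
  by rewrite map_inj_uniq //; exact: invg_inj.
move=> a; apply/mapP/idP => [[b sb ->]|sa]; first exact: s_sym.
by exists a^-1%g; rewrite ?invgK // s_sym.
Qed.

(** The diagonal pairs [(a, a^-1)] alone suffice: going forth and back along [a]
recovers first differences from second ones. *)
Lemma CD0_abelian_cayley n : (size s <= n)%N -> CD0 R adj n%:R.
Proof.
move=> le_sn f x; rewrite Gamma2_cayley.
have le_diag : \sum_(a <- s) (diffg a f x + diffg a^-1%g f x) ^+ 2 <=
    \sum_(a <- s) \sum_(b <- s) diffg b (diffg a f) x ^+ 2.
  rewrite big_seq [leRHS]big_seq; apply: ler_sum => a sa.
  rewrite (bigD1_seq a^-1%g) ?s_sym //=.
  have -> : diffg a^-1%g (diffg a f) x = - (diffg a f x + diffg a^-1%g f x).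
    by rewrite /diffg mulgVK; ring.
  by rewrite sqrrN lerDl; apply: sumr_ge0 => b _; exact: sqr_ge0.
have := sqr_sum_le (fun a => diffg a f x + diffg a^-1%g f x) le_sn.
rewrite big_split /= sum_diffgV -laplacian_cayley.
lra.
Qed.

End FiniteCayley.

Theorem corollary3p9 (R : realType) (G : groupType)
    (Gabelian : forall x y : G, (x * y)%g = (y * x)%g)
    (N : nat) (eplus eminus : 'I_N -> G) (S : set G)
    (SE : S = range eplus `|` range eminus)
    (eminusE : forall i, eminus i = (eplus i)^-1%g)
    (Sgen : generates S)
    (S1 : ~ S 1%g) :
  CD0 R (cayley_adj S) (2 * N)%:R.
Proof.
pose s := undup (codom eplus ++ codom eminus).
have SEs : S = [set` s].
  rewrite SE; apply/seteqP; split=> a /=; rewrite mem_undup mem_cat.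
    by case=> -[i _ <-]; rewrite codom_f ?orbT.
  by case/orP=> /codomP[i ->]; [left | right]; exists i.
rewrite SEs; apply: CD0_abelian_cayley => //; first exact: undup_uniq.
  move=> a; rewrite !mem_undup !mem_cat => /orP[] /codomP[i ->].
    by rewrite -eminusE codom_f orbT.
  by rewrite eminusE invgK codom_f.
by rewrite (leq_trans (size_undup _)) // size_cat !size_codom card_ord mul2n addnn.
Qed.
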